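(* Let $p>0$ and let $A:[0,1]\times\mathbb{R}\to\mathbb{R}$ be of the form $A(t,x)=px+B(t,x)$, where $B:[0,1]\times\mathbb{R}\to\mathbb{R}$ is continuous and satisfies: (1) $\sup_{0\le t\le 1}\sup_{x\in\mathbb{R}}|B(t,x)|<\infty$; (2) the partial derivative $B'_x(t,x)=\partial B(t,x)/\partial x$ exists for all $(t,x)\in[0,1]\times\mathbb{R}$, satisfies $\sup_{0\le t\le 1}\sup_{x\in\mathbb{R}}|B'_x(t,x)|<p$, and $$\lim_{h\to 0^+}\ \sup_{0\le t\le 1}\ \sup_{|x-y|\le h}\left|B'_x(t,x)-B'_x(t,y)\right|=0 .$$ Let $f:[0,1]\to\mathbb{R}$ be continuous, let $\delta:[0,1]\to\mathbb{R}$ be (deterministic and) square integrable, and let $(W_t)_{0\le t\le 1}$ be a standard Brownian motion. Then the function $$B_0(x)=x+\frac1p\int_0^1B(s,x)\,\mathrm{d}s,\qquad x\in\mathbb{R},$$ is invertible on $\mathbb{R}$ (a bijection $\mathbb{R}\to\mathbb{R}$). Moreover, define the random variable $$\zeta=B_0^{-1}(\eta),\qquad \eta=-\frac1p\int_0^1f(s)\,\mathrm{d}s-\frac1p\int_0^1\delta(s)\,\mathrm{d}W_s ,$$ and for all sufficiently small $\varepsilon>0$ let $x^\varepsilon$ be the solution of $$\mathrm{d}\dot{x}^{\varepsilon}(t)=\varepsilon^2\left(A(t,x^{\varepsilon}(t))+f(t)\right)\mathrm{d}t+\varepsilon^2\,\delta(t)\,\mathrm{d}W_t,\qquad 0\le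 t\le 1,$$ with either the boundary conditions $\dot x^\varepsilon(0)=\dot x^\varepsilon(1)=0$, or the boundary conditions $x^\varepsilon(0)=x^\varepsilon(1)$ and $\dot x^\varepsilon(0)=\dot x^\varepsilon(1)$. Then in each of these two cases, as $\varepsilon\to0$, $$\sup_{0\le t\le 1}\left|x^{\varepsilon}(t)-\zeta\right|\longrightarrow 0\quad\text{in probability.}$$
   Context: A solution of the boundary value problem, for a given Brownian motion $(W_t)_{0\le t\le 1}$ on a given probability space, is a process $x^\varepsilon=(x^\varepsilon(t))_{0\le t\le 1}$ on that same probability space, measurable with respect to the completed $\sigma$-algebra generated by $(W_t)_{0\le t\le1}$ (not required to be adapted to the filtration of $W$), whose paths are almost surely continuously differentiable on $[0,1]$ (with derivative $\dot x^\varepsilon$), and such that almost surely the boundary condition holds and, for all $t\in[0,1]$, $$\dot x^\varepsilon(t)=\dot x^\varepsilon(0)+\varepsilon^2\int_0^t\left(A(s,x^\varepsilon(s))+f(s)\right)\mathrm{d}s+\varepsilon^2\int_0^t\delta(s)\,\mathrm{d}W_s .$$ Under the stated hypotheses there is a nonrandom $\varepsilon_0>0$ such that for every $0<\varepsilon\le\varepsilon_0$ and each of the boundary conditions considered such a solution exists and is almost surely unique. Stochastic integrals of deterministic functions are Wiener integrals. *)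

(* Defs.v *)
From HB Require Import structures.
From mathcomp Require Import all_boot all_order all_algebra.
From mathcomp Require Import all_classical all_reals all_analysis.

Set Implicit Arguments.
Unset Strict Implicit.
Unset Printing Implicit Defensive.

Import Order.TTheory GRing.Theory Num.Theory.
Import numFieldNormedType.Exports.

Local Open Scope classical_set_scope.
Local Open Scope ring_scope.

Section Stochastic.
Context {R : realType} {d : measure_display} {T : measurableType d}.
Variable P : probability T R.
Local Notation lambda := (@lebesgue_measure R).

(* The product rule over sub-families is the case where some A i are setT. *)
Definition independent_increments (W : R -> T -> R) : Prop :=
  forall (n : nat) (t : nat -> R) (A : nat -> set R),
    (forall i, (i <= n)%N -> 0 <= t i <= 1) ->
    (forall i, (i < n)%N -> t i <= t i.+1) ->
    (forall i, (i < n)%N -> measurable (A i)) ->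
    let E := fun i => [set w | A i (W (t i.+1) w - W (t i) w)] in
    P (\bigcap_(i in [set i | (i < n)%N]) E i) = (\prod_(i < n) P (E i))%E.

(* Only the values W t with 0 <= t <= 1 matter.  The second argument of
   normal_prob is the standard deviation. *)
Definition brownian_motion (W : R -> T -> R) : Prop :=
  [/\ forall t : R, 0 <= t <= 1 -> measurable_fun [set: T] (W t),
      {ae P, forall w, W 0 w = 0},
      independent_increments W,
      forall s t : R, 0 <= s -> s < t -> t <= 1 ->
        forall A : set R, measurable A ->
          P [set w | A (W t w - W s w)] = normal_prob 0 (Num.sqrt (t - s)) A &
      {ae P, forall w, {within `[0, 1], continuous (fun t : R => W t w)}}].

(* A list of triples (a, (u, v)) encodes the step function given by the sum of
   the a * \1_]u, v], whose stochastic integral is the corresponding sum of the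
   a * (W_v - W_u). *)
Definition step01 (s : seq (R * (R * R))) : bool :=
  all (fun k => (0 <= k.2.1) && (k.2.1 <= k.2.2) && (k.2.2 <= 1)) s.

Definition step_fun (s : seq (R * (R * R))) (t : R) : R :=
  \sum_(k <- s) k.1 * \1_(`]k.2.1, k.2.2]) t.

Definition step_integral (W : R -> T -> R) (s : seq (R * (R * R))) (w : T) : R :=
  \sum_(k <- s) k.1 * (W k.2.2 w - W k.2.1 w).

(* X is a version of the Wiener integral of g over [0, 1]: the limit in L^2(P)
   of the integrals of step functions converging to g in L^2([0, 1]).  It is
   a relation because the integral is only defined up to P-null sets. *)
Definition is_wiener_integral (W : R -> T -> R) (g : R -> R) (X : T -> R) :
    Prop :=
  measurable_fun [set: T] X /\
  exists s : nat -> seq (R * (R * R)),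
    [/\ forall n, step01 (s n),
        (\int[lambda]_(t in `[0%R, 1%R]) ((g t - step_fun (s n) t) ^+ 2)%:E)%E
          @[n --> \oo] --> 0%E &
        'E_P[(fun w => (X w - step_integral W (s n) w) ^+ 2)%R]%E
          @[n --> \oo] --> 0%E].

(* Completed sigma-algebra generated by (W_t), 0 <= t <= 1: all P-negligible
   sets of the underlying space are adjoined. *)
Definition completed_sigma_algebra (W : R -> T -> R) : set (set T) :=
  <<s [set E | exists (t : R) (C : set R),
         [/\ 0 <= t <= 1, measurable C & E = W t @^-1` C]]
      `|` [set N | P.-negligible N] >>.

(* The derivative is one-sided at the end points 0 and 1. *)
Definition C1_on01 (y dy : R -> R) : Prop :=
  {within `[0, 1], continuous dy} /\
  forall t : R, 0 <= t <= 1 ->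
    (y s - y t) / (s - t) @[s --> within `[0, 1] t^'] --> dy t.

Inductive boundary_condition : Set := Neumann | Periodic.

Definition satisfies_bc (bc : boundary_condition) (y dy : R -> R) : Prop :=
  match bc with
  | Neumann => dy 0 = 0 /\ dy 1 = 0
  | Periodic => y 0 = y 1 /\ dy 0 = dy 1
  end.

(* M t is a version of the integral of delta over [0, t] against W.  The
   equation holds for all t outside a single null set, so it forces M to be
   the almost surely continuous version of the integral process. *)
Definition is_solution (W : R -> T -> R) (A : R -> R -> R) (f delta : R -> R)
    (bc : boundary_condition) (eps : R) (x : R -> T -> R) : Prop :=
  (forall t : R, 0 <= t <= 1 -> forall C : set R, measurable C ->
     completed_sigma_algebra W (x t @^-1` C)) /\
  exists xdot M : R -> T -> R,
    (forall t : R, 0 <= t <= 1 ->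
       is_wiener_integral W (fun s => delta s * \1_(`[0, t]) s) (M t)) /\
    {ae P, forall w,
      [/\ C1_on01 (x ^~ w) (xdot ^~ w),
          satisfies_bc bc (x ^~ w) (xdot ^~ w) &
          forall t : R, 0 <= t <= 1 ->
            xdot t w = xdot 0 w
              + eps ^+ 2 * (\int[lambda]_(s in `[0, t]) (A s (x s w) + f s))
              + eps ^+ 2 * M t w]}.

(* Convergence to 0 in probability of [0, +oo]-valued functions along F.  The
   outer measure P^* agrees with the completion of P on events that are
   measurable up to null sets; the underlying probability space is not assumed to be complete. *)
Definition cvg_in_probability0 {I : Type} (F : set_system I)
    (Y : I -> T -> \bar R) : Prop :=
  forall r : R, 0 < r ->
    (P^*)%mu [set w | (r%:E < Y i w)%E] @[i --> F] --> 0%E.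

End Stochastic.

Definition square_integrable01 {R : realType} (g : R -> R) : Prop :=
  measurable_fun (`[0, 1] : set R) g /\
  (\int[@lebesgue_measure R]_(t in `[0%R, 1%R]) ((g t) ^+ 2)%:E < +oo)%E.

Definition sup_norm {R : realType} {U : Type} (D : set U) (g : U -> R) : \bar R :=
  ereal_sup [set `|g u|%:E | u in D].

Definition partial_x {R : realType} (B : R -> R -> R) (t x : R) : R :=
  derive1 (B t) x.

(* Main.v *)
Require Import Defs.
From HB Require Import structures.
From mathcomp Require Import all_boot all_order all_algebra.
From mathcomp Require Import all_classical all_reals all_analysis.
From mathcomp Require Import measurable_realfun ring lra.
Set Implicit Arguments.
Unset Strict Implicit.
Unset Printing Implicit Defensive.
Import Order.TTheory GRing.Theory Num.Theory.
Import numFieldNormedType.Exports.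
Local Open Scope classical_set_scope.
Local Open Scope ring_scope.

(** The solution is squeezed between a slow motion and an averaged balance.

    Integrating the equation over [0, 1], either boundary condition makes the
    two end values of the velocity agree, so that after division by eps ^ 2
      p * (integral of x) + (integral of B(s, x(s))) + (integral of f)
        + (Wiener integral of delta) = 0.
    On the other hand the velocity vanishes somewhere (at 0 in the Neumann
    case, by Rolle in the periodic case) and the equation makes its variation
    of order eps ^ 2; hence x oscillates by O(eps ^ 2) only. Replacing x(s) by
    x(t) in the balance therefore costs O(eps ^ 2), and the balance then says
    that B_0(x(t)) = eta + O(eps ^ 2). Since B is Lipschitz in x with a constant
    L < p, the map B_0 expands distances by at least (p - L) / p
    (averaged_drift_expands), so x(t) = zeta + O(eps ^ 2). All of this is
    pathwise (bvp_distance_le); the constant depends on the path only through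
    a bound S on the stochastic term M_t, t in [0, 1].

    Probability enters only to choose S independently of eps. The process M
    belongs to the solution and may change with eps, but two versions of a
    Wiener integral are almost surely equal (wiener_integral_unique), hence the
    processes attached to all small eps agree, almost surely for each of them,
    at every rational time. Rational times are enough to control the velocity,
    which is continuous. For a single reference value of eps the equation itself
    shows that the path of M is bounded (forcing_bounded), so the events
    that |M| exceeds k at some rational time decrease to a null set, and off
    these events the pathwise estimate tends to 0
    (cvg_in_probability0_off_events).

    Uniqueness of the Wiener integral comes from the isometry on step
    functions. Polarization expresses the product of two increments through
    squares of increments, so that the isometry needs only
    E (W_s - W_t) ^ 2 = m * |s - t| with some finite constant m, the same for
    all s and t; m is the second moment of the standard normal law. *)

(** * Second moments of normal laws *)

(** A Radon-Nikodym derivative is determined almost everywhere by its integrals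
    over measurable sets, and the explicit density has the same ones. *)
Lemma integral_normal_prob {R : realType} (m s : R) (f : measurableTypeR R -> \bar R) :
  (forall x, 0 <= f x)%E -> measurable_fun [set: R] f ->
  (\int[normal_prob m s]_x f x =
   \int[@lebesgue_measure R]_x (f x * (normal_pdf m s x)%:E))%E.
Proof.
move=> f0 mf; have dom := @normal_prob_dominates R m s.
have mpdf := measurable_normal_pdf m s.
rewrite -(Radon_Nikodym_SigmaFinite.change_of_variables dom)//.
have iRN := Radon_Nikodym_SigmaFinite.f_integrable dom.
apply: ae_eq_integral => //.
- by apply: emeasurable_funM => //; exact: measurable_int iRN.
- by apply: emeasurable_funM => //; exact/measurable_EFinP.
- apply: ae_eqe_mul2l => /=.
  apply: integral_ae_eq => //=; first exact/measurable_EFinP.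
  by move=> E _ mE; rewrite -(Radon_Nikodym_SigmaFinite.f_integral dom).
Qed.

(** Substituting x / s for the integration variable. Only the dependence
    on s matters for the isometry, so the moment at s = 1 is not evaluated. *)
Lemma normal_second_moment_scale {R : realType} (s : R) : 0 < s ->
  (\int[normal_prob 0 s]_x (x ^+ 2)%:E =
   (s ^+ 2)%:E * \int[normal_prob 0 1]_x (x ^+ 2)%:E)%E.
Proof.
move=> s0.
have m2 : measurable_fun [set: R] (fun x : R => (x ^+ 2)%:E).
  by apply/measurable_EFinP; exact: exprn_measurable.
have sq0 (x : R) : (0 <= (x ^+ 2)%:E)%E by rewrite lee_fin sqr_ge0.
rewrite !integral_normal_prob//.
pose G (y : R) := y ^+ 2 * normal_pdf 0 1 y.
pose F (x : R) := x / s.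
have F'E : F^`()%classic = cst s^-1.
  apply/funext => x; rewrite /F derive1E deriveM// derive_cst scaler0.
  by rewrite add0r derive_id scaler1.
under [in RHS]eq_integral do rewrite -EFinM -/(G _).
rewrite (@increasing_ge0_integration_by_substitutionT R F G).
- rewrite -ge0_integralZl//=; last 2 first.
  + apply/measurable_EFinP; rewrite F'E; apply: measurable_funM => //.
    apply: (measurableT_comp (f:=G)).
      apply: measurable_funM; first exact: exprn_measurable.
      exact: measurable_normal_pdf.
    exact: measurable_funM.
  + move=> x _; rewrite lee_fin !fctE F'E /= mulr_ge0 ?invr_ge0 ?(ltW s0)//.
    by rewrite mulr_ge0 ?sqr_ge0 ?normal_pdf_ge0.
  apply: eq_integral => x _; rewrite -!EFinM !fctE F'E /G /F /=; congr EFin.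
  rewrite !normal_pdfE ?oner_neq0 ?gt_eqF// /normal_fun.
  rewrite /normal_peak expr1n mul1r subr0 subr0 -mulrnAr sqrtrM ?sqr_ge0//.
  rewrite sqrtr_sqr gtr0_norm// invfM.
  rewrite (_ : - (x / s) ^+ 2 / (1 *+ 2) = - x ^+ 2 / (s ^+ 2 *+ 2)); last by field; rewrite gt_eqF.
  move: (expR _) (Num.sqrt (pi *+ 2))^-1 => u v.
  by field; rewrite gt_eqF.
- by move=> x y xy; rewrite /F ltr_pM2r ?invr_gt0.
- by rewrite F'E => ?; exact: cvg_cst.
- by rewrite F'E; exact: is_cvg_cst.
- by rewrite F'E; exact: is_cvg_cst.
- by move=> x; exact: derivableM.
- by apply/gt0_cvgMlNy; rewrite ?invr_gt0//; exact: cvg_id.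
- by apply/gt0_cvgMly; rewrite ?invr_gt0//; exact: cvg_id.
- move=> x; apply: cvgM; first exact: exprn_continuous.
  by apply: continuous_normal_pdf; rewrite oner_neq0.
- by move=> x; rewrite mulr_ge0 ?sqr_ge0 ?normal_pdf_ge0.
Qed.

(** The quadratic factor is absorbed by part of the exponential, since
    u <= exp u with u = x ^ 2 / 4; what remains is a multiple of the normal
    density of variance 2. *)
Lemma normal_second_moment_fin {R : realType} :
  (\int[@normal_prob R 0 1]_x (x ^+ 2)%:E < +oo)%E.
Proof.
have m2 : measurable_fun [set: R] (fun x : R => (x ^+ 2)%:E).
  by apply/measurable_EFinP; exact: exprn_measurable.
rewrite integral_normal_prob//; last by move=> x; rewrite lee_fin sqr_ge0.
pose r : R := Num.sqrt 2.
have r0 : r != 0 by rewrite gt_eqF// sqrtr_gt0.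
pose c := 4 * normal_peak 1 * (normal_peak r)^-1.
have peak_neq0 : normal_peak r != 0 by rewrite gt_eqF// normal_peak_gt0.
have pk0 := @normal_peak_ge0 R.
apply: (@le_lt_trans _ _ (\int[lebesgue_measure]_x (c%:E * (normal_pdf 0 r x)%:E))%E).
  apply: ge0_le_integral => //=.
  - by move=> x _; rewrite mule_ge0// lee_fin ?sqr_ge0 ?normal_pdf_ge0.
  - by apply: emeasurable_funM => //; apply/measurable_EFinP; exact: measurable_normal_pdf.
  - by apply/measurable_EFinP/measurable_funM => //; exact: measurable_normal_pdf.
  - move=> x _; rewrite -!EFinM lee_fin !normal_pdfE ?oner_neq0// /c.
    have -> : 4 * normal_peak 1 / normal_peak r * (normal_peak r * normal_fun 0 r x) =
      normal_peak 1 * (4 * normal_fun 0 r x) by field.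
    rewrite mulrCA.
    rewrite ler_wpM2l// /normal_fun subr0 expr1n sqr_sqrtr//.
    rewrite (_ : - x ^+ 2 / (1 *+ 2) = - (x^+ 2 / 4) + - x ^+ 2 / (2 *+ 2)); last by field.
    rewrite expRD mulrA ler_wpM2r ?expR_ge0// expRN -[leRHS]mul1r.
    rewrite ler_pdivrMr ?expR_gt0// mul1r.
    have := expR_ge1Dx (x ^+ 2 / 4); lra.
rewrite ge0_integralZl//=.
- by rewrite integral_normal_pdf mule1 ltry.
- by apply/measurable_EFinP; exact: measurable_normal_pdf.
- by move=> x _; rewrite lee_fin normal_pdf_ge0.
- by rewrite lee_fin /c !mulr_ge0 ?invr_ge0.
Qed.

(** * Isometry on step functions *)

(** Integrability and the value of the integral travel together, so that sums
    can be integrated term by term without separate integrability proofs. *)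
Definition has_integral {d} {T : measurableType d} {R : realType}
    (mu : {measure set T -> \bar R}) (D : set T) (f : T -> R) (c : R) : Prop :=
  mu.-integrable D (EFin \o f) /\ (\int[mu]_(x in D) (f x)%:E = c%:E)%E.

Section has_integral_theory.
Context {d} {T : measurableType d} {R : realType}.
Variables (mu : {measure set T -> \bar R}) (D : set T).
Hypothesis mD : measurable D.
Local Notation hasI := (has_integral mu D).

Lemma has_integralD f g a b : hasI f a -> hasI g b -> hasI (f \+ g) (a + b).
Proof.
move=> [If Ef] [Ig Eg]; split.
  by rewrite (_ : _ \o _ = (EFin \o f) \+ (EFin \o g))%E//; exact: integrableD.
under eq_integral do rewrite /= EFinD.
by rewrite integralD//= Ef Eg.
Qed.

Lemma has_integralZ f a k : hasI f a -> hasI (fun x => k * f x) (k * a).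
Proof.
move=> [If Ef]; split.
  rewrite (_ : _ \o _ = (fun x => k%:E * (EFin \o f) x))%E//.
  exact: integrableZl.
under eq_integral do rewrite /= EFinM.
by rewrite integralZl//= Ef.
Qed.

Lemma has_integral_sum (I : eqType) (r : seq I) (F : I -> T -> R) (c : I -> R) :
  (forall i, i \in r -> hasI (F i) (c i)) ->
  hasI (fun x => \sum_(i <- r) F i x) (\sum_(i <- r) c i).
Proof.
elim: r => [_|i r IHr Fr].
  rewrite big_nil (_ : (fun _ => _) = cst 0); last first.
    by apply/funext => x; rewrite big_nil.
  by split; [exact: integrable0|rewrite integral0].
rewrite big_cons (_ : (fun _ => _) = F i \+ (fun x => \sum_(j <- r) F j x)).
  by apply: has_integralD;
    [exact/Fr/mem_head|apply: IHr => j jr; apply: Fr; rewrite inE jr orbT].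
by apply/funext => x; rewrite big_cons.
Qed.

End has_integral_theory.

(** The squared norm of the sum of a_k (H(v_k) - H(u_k)), for a curve H in a
    Hilbert space with |H(s) - H(t)| ^ 2 = |s - t|: each inner product of
    increments is expanded by polarization. *)
Definition step_cov {R : realType} (s : seq (R * (R * R))) : R :=
  \sum_(k <- s) \sum_(l <- s) (k.1 * l.1 / 2) *
    (`|k.2.2 - l.2.1| + `|k.2.1 - l.2.2|
     - `|k.2.2 - l.2.2| - `|k.2.1 - l.2.1|).

Section isometry.
Context {d} {T : measurableType d} {R : realType}.
Variables (mu : {measure set T -> \bar R}) (D : set T).
Hypothesis mD : measurable D.
Variables (H : R -> T -> R) (C : R).
Hypothesis mH : forall t, 0 <= t <= 1 -> measurable_fun D (H t).
Hypothesis HC : forall s t, 0 <= s <= 1 -> 0 <= t <= 1 ->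
  (\int[mu]_(x in D) ((H s x - H t x) ^+ 2)%:E = (C * `|s - t|)%:E)%E.

(** The right-hand side does not mention H, which is what makes this an
    isometry: it is used once with H = W on the probability space and once with
    H t the indicator of ]0, t] on [0, 1]. *)
Lemma step_integral_isometry s : step01 s ->
  has_integral mu D (fun x => step_integral H s x ^+ 2) (C * step_cov s).
Proof.
move=> /allP s01.
have hC u v : 0 <= u <= 1 -> 0 <= v <= 1 ->
    has_integral mu D (fun x => (H u x - H v x) ^+ 2) (C * `|u - v|).
  move=> u01 v01; split; last exact: HC.
  apply/integrableP; split.
    by apply/measurable_EFinP/measurable_funX/measurable_funB; exact: mH.
  under eq_integral do rewrite /= ger0_norm ?sqr_ge0//.
  by rewrite HC// ltry.
(* Polarization: 2 (a - b) (c - d) =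
   (a - d) ^ 2 + (b - c) ^ 2 - (a - c) ^ 2 - (b - d) ^ 2. *)
rewrite (_ : (fun _ => _) = fun x => \sum_(k <- s) \sum_(l <- s)
    (k.1 * l.1 / 2) * ((H k.2.2 x - H l.2.1 x) ^+ 2 + (H k.2.1 x - H l.2.2 x) ^+ 2
      + (- 1) * (H k.2.2 x - H l.2.2 x) ^+ 2
      + (- 1) * (H k.2.1 x - H l.2.1 x) ^+ 2)); last first.
  apply/funext => x; rewrite /step_integral expr2 mulr_suml.
  apply: eq_bigr => k _; rewrite mulr_sumr; apply: eq_bigr => l _; by field.
rewrite /step_cov mulr_sumr; apply: has_integral_sum => // k ks.
rewrite mulr_sumr; apply: has_integral_sum => // l ls.
have lek (j : R * (R * R)) : j \in s -> 0 <= j.2.1 <= 1 /\ 0 <= j.2.2 <= 1.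
  move=> /s01 /andP[/andP[j0 jj] j1].
  by rewrite j0 j1 (le_trans jj j1) (le_trans j0 jj).
have [k1 k2] := lek _ ks; have [l1 l2] := lek _ ls.
rewrite mulrCA; apply: has_integralZ => //.
rewrite -[- `|_| in X in has_integral _ _ _ X]mulN1r.
rewrite -[- `|_| in X in has_integral _ _ _ X]mulN1r !mulrDr.
rewrite ![C * (-1 * _)]mulrCA.
by do !apply: has_integralD => //; try (by apply: hC);
  apply: has_integralZ => //; exact: hC.
Qed.

End isometry.

(** Step functions are themselves step integrals, against the curve of
    indicators of ]0, u]. *)
Lemma step_fun_step_integral {R : realType} (s : seq (R * (R * R))) (t : R) :
  step01 s ->
  step_fun s t =
  step_integral (fun u (x : measurableTypeR R) => \1_(`]0, u]) x) s t.
Proof.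
move=> /allP s01; apply: eq_big_seq => k /s01 /andP[/andP[k0 kk] k1].
congr (_ * _); rewrite !indicE !mem_setE !in_itv/=.
have [kt|tk] := ltP k.2.1 t.
  by rewrite (le_lt_trans k0 kt)/= subr0.
by rewrite (le_trans tk kk) /= subrr.
Qed.

Lemma indicator_isometry {R : realType} (s t : R) : 0 <= s <= 1 -> 0 <= t <= 1 ->
  (\int[@lebesgue_measure R]_(x in `[0%R, 1%R])
     ((\1_(`]0, s]) x - \1_(`]0, t]) x) ^+ 2)%:E = (1 * `|s - t|)%:E)%E.
Proof.
wlog st : s t / s <= t.
  move=> wl s01 t01; have [st|/ltW ts] := leP s t; first exact: wl.
  rewrite distrC -wl//; apply: eq_integral => x _.
  by rewrite -sqrrN opprB.
move=> /andP[s0 s1] /andP[t0 t1].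
transitivity (\int[@lebesgue_measure R]_(x in `[0%R, 1%R]) (\1_(`]s, t]) x)%:E)%E.
  apply: eq_integral => x _; rewrite !indicE !mem_setE !in_itv/=; congr EFin.
  have [sx|xs] := ltP s x.
    by rewrite (le_lt_trans s0 sx)/= sub0r sqrrN; case: (x <= t); rewrite ?expr1n ?expr0n.
  by rewrite (le_trans xs st) /= subrr expr0n.
rewrite integral_indic//= (_ : _ `&` _ = `]s, t]%classic); last first.
  apply/seteqP; split => [x [] //|x /=]; rewrite !in_itv/= => /andP[sx xt]; split.
    by rewrite sx xt.
  by rewrite (le_trans s0 (ltW sx)) (le_trans xt t1).
by rewrite lebesgue_measure_itv/= lte_fin mul1r; have [st'|] := ltP s t;
  [rewrite ltr0_norm ?subr_lt0// opprB
  |move=> ts; rewrite (_ : s = t) ?subrr ?normr0//; apply/eqP; rewrite eq_le st].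
Qed.

(** * Uniqueness of the Wiener integral *)

Section mean_square_distance.
Context {d} {T : measurableType d} {R : realType}.
Variables (mu : {measure set T -> \bar R}) (D : set T).
Hypothesis mD : measurable D.

Definition sqdist (f g : T -> R) : \bar R :=
  (\int[mu]_(x in D) ((f x - g x) ^+ 2)%:E)%E.

Lemma sqdist_ge0 f g : (0 <= sqdist f g)%E.
Proof. by apply: integral_ge0 => x _; rewrite lee_fin sqr_ge0. Qed.

Lemma sqdistC f g : sqdist f g = sqdist g f.
Proof. by apply: eq_integral => x _; rewrite -sqrrN opprB. Qed.

(** From (a + b) ^ 2 <= 2 a ^ 2 + 2 b ^ 2; it replaces the triangle inequality
    without taking square roots of possibly infinite integrals. *)
Lemma le_sqdist g f h :
  measurable_fun D f -> measurable_fun D g -> measurable_fun D h ->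
  (sqdist f h <= 2%:E * (sqdist f g + sqdist g h))%E.
Proof.
move=> mf mg mh.
have m2 (u v : T -> R) : measurable_fun D u -> measurable_fun D v ->
    measurable_fun D (fun x => ((u x - v x) ^+ 2)%:E).
  by move=> mu' mv; apply/measurable_EFinP/measurable_funX/measurable_funB.
have ge0 (u v : T -> R) x : D x -> (0 <= ((u x - v x) ^+ 2)%:E :> \bar R)%E.
  by rewrite lee_fin sqr_ge0.
rewrite -ge0_integralD//=; try by [apply: m2 | move=> x Dx; apply: ge0].
rewrite -ge0_integralZl//=; last 2 first.
- by apply: emeasurable_funD; apply: m2.
- by move=> x Dx; rewrite adde_ge0// ge0.
apply: ge0_le_integral => //=.
- by move=> x Dx; apply: ge0.
- exact: m2.
- by apply: emeasurable_funM => //; apply: emeasurable_funD; apply: m2.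
- move=> x _; rewrite -EFinD -EFinM lee_fin.
  have := sqr_ge0 ((f x - g x) - (g x - h x)); nra.
Qed.

Lemma sqdist_eq0 f g :
  measurable_fun D f -> measurable_fun D g -> (sqdist f g <= 0)%E ->
  {ae mu, forall x, D x -> f x = g x}.
Proof.
move=> mf mg d0.
have mfg : measurable_fun D (fun x => ((f x - g x) ^+ 2)%:E).
  by apply/measurable_EFinP/measurable_funX/measurable_funB.
have : ae_eq mu D (fun x => ((f x - g x) ^+ 2)%:E) (cst 0%E).
  apply/(ae_eq_integral_abs mu mD mfg).
  under eq_integral do rewrite gee0_abs ?lee_fin ?sqr_ge0//.
  by apply/eqP; rewrite eq_le d0 sqdist_ge0.
apply: filterS => x fg Dx; move: (fg Dx) => [] /eqP.
by rewrite sqrf_eq0 subr_eq0 => /eqP.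
Qed.

End mean_square_distance.

Section wiener.
Context {R : realType} {d} {T : measurableType d}.
Variables (P : probability T R) (W : R -> T -> R).
Hypothesis Wbm : brownian_motion P W.

Let m2 : R := fine (\int[@normal_prob R 0 1]_x (x ^+ 2)%:E)%E.

Let m2E : (\int[@normal_prob R 0 1]_x (x ^+ 2)%:E = m2%:E)%E.
Proof.
rewrite /m2 fineK// ge0_fin_numE ?normal_second_moment_fin//.
by apply: integral_ge0 => x _; rewrite lee_fin sqr_ge0.
Qed.

Let mW t : 0 <= t <= 1 -> measurable_fun [set: T] (W t).
Proof. by case: Wbm => + _ _ _ _; apply. Qed.

Lemma brownian_isometry s t : 0 <= s <= 1 -> 0 <= t <= 1 ->
  (\int[P]_w ((W s w - W t w) ^+ 2)%:E = (m2 * `|s - t|)%:E)%E.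
Proof.
wlog st : s t / s <= t.
  move=> wl s01 t01; have [st|/ltW ts] := leP s t; first exact: wl.
  rewrite distrC -wl//; apply: eq_integral => x _.
  by rewrite -sqrrN opprB.
move=> s01 t01; move: st; rewrite le_eqVlt => /predU1P[->|st].
  under eq_integral do rewrite subrr expr0n.
  by rewrite integral0 subrr normr0 mulr0.
have mWts : measurable_fun [set: T] (fun w => W t w - W s w).
  by apply: measurable_funB; exact: mW.
case: Wbm => _ _ _ law _.
have [s0 t1] : 0 <= s /\ t <= 1 by move/andP: s01 => []; move/andP: t01 => [].
have st0 : 0 < Num.sqrt (t - s) by rewrite sqrtr_gt0 subr_gt0.
have msq : measurable_fun [set: R] (fun x : R => (x ^+ 2)%:E).
  by apply/measurable_EFinP; exact: exprn_measurable.
pose dW w : measurableTypeR R := W t w - W s w.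
transitivity (\int[pushforward P dW]_x (x ^+ 2)%:E)%E.
  rewrite ge0_integral_pushforward//=; last by move=> x _; rewrite lee_fin sqr_ge0.
  by rewrite preimage_setT; apply: eq_integral => w _; rewrite -sqrrN opprB.
rewrite (@eq_measure_integral _ _ _ _ (normal_prob 0 (Num.sqrt (t - s)))).
  rewrite normal_second_moment_scale// m2E -EFinM sqr_sqrtr ?subr_ge0 ?ltW//.
  by rewrite distrC gtr0_norm ?subr_gt0// mulrC.
by move=> A mA _; rewrite /pushforward/= -law.
Qed.

Lemma step_integral_diff (s1 s2 : seq (R * (R * R))) (V : R -> T -> R) w :
  step_integral V (s1 ++ [seq (- k.1, k.2) | k <- s2]) w =
  step_integral V s1 w - step_integral V s2 w.
Proof.
rewrite /step_integral big_cat big_map/=; congr (_ + _).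
by rewrite -sumrN; apply: eq_bigr => k _; rewrite mulNr.
Qed.

Lemma step_fun_diff (s1 s2 : seq (R * (R * R))) t :
  step_fun (s1 ++ [seq (- k.1, k.2) | k <- s2]) t = step_fun s1 t - step_fun s2 t.
Proof.
rewrite /step_fun big_cat big_map/=; congr (_ + _).
by rewrite -sumrN; apply: eq_bigr => k _; rewrite mulNr.
Qed.

Lemma measurable_step_integral s : step01 s ->
  measurable_fun [set: T] (step_integral W s).
Proof.
elim: s => [_|k s IHs /= /andP[/andP[/andP[k0 kk] k1] /IHs {}IHs]].
  rewrite (_ : step_integral _ _ = cst 0)//.
  by apply/funext => w; rewrite /step_integral big_nil.
rewrite (_ : step_integral _ _ = (fun w => k.1 * (W k.2.2 w - W k.2.1 w))
    \+ step_integral W s); last first.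
  by apply/funext => w; rewrite /step_integral big_cons.
apply: measurable_funD => //.
apply: measurable_funM => //; apply: measurable_funB; apply: mW.
  by rewrite k1 (le_trans k0 kk).
by rewrite k0 (le_trans kk k1).
Qed.

Lemma measurable_step_fun (s : seq (R * (R * R))) (D : set R) :
  measurable_fun D (step_fun s).
Proof.
apply: measurable_sum => k; apply: measurable_funM => //.
Qed.

(** Concatenating s1 with the opposite of s2 reduces the distance of two step
    integrals to the square of a single one. *)
Lemma wiener_isometry s1 s2 : step01 s1 -> step01 s2 ->
  (sqdist P setT (step_integral W s1) (step_integral W s2) =
   m2%:E * sqdist (@lebesgue_measure R) `[0%R, 1%R] (step_fun s1) (step_fun s2))%E.
Proof.
move=> h1 h2; pose s := s1 ++ [seq (- k.1, k.2) | k <- s2].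
have hs : step01 s by rewrite /step01 all_cat all_map; apply/andP; split.
have [_ E1] := step_integral_isometry measurableT (fun t h => mW h) brownian_isometry hs.
have mI (t : R) : 0 <= t <= 1 -> measurable_fun (`[0, 1] : set (measurableTypeR R))
    (\1_(`]0, t]) : measurableTypeR R -> R) by move=> _; exact: measurable_indic.
have [_ E2] := step_integral_isometry (mu := @lebesgue_measure R)
  (measurable_itv `[0%R, 1%R]) mI (@indicator_isometry R) hs.
rewrite /sqdist.
under eq_integral do rewrite -step_integral_diff.
rewrite E1 mulrC EFinM muleC; congr (_ * _)%E.
rewrite mul1r in E2; rewrite -E2.
by apply: eq_integral => t _; rewrite -step_fun_step_integral// step_fun_diff.
Qed.

(** The approximating sequences of X and Y may differ; by the isometry their
    step integrals are as close as their step functions, which both converge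
    to g. *)
Lemma wiener_integral_unique g X Y :
  measurable_fun (`[0, 1] : set R) g ->
  is_wiener_integral P W g X -> is_wiener_integral P W g Y ->
  {ae P, forall w, X w = Y w}.
Proof.
move=> mg [mX [s [hs cs Xs]]] [mY [u [hu cu Yu]]].
suff : {ae P, forall w, [set: T] w -> X w = Y w} by apply: filterS => w; apply.
apply: sqdist_eq0 => //.
pose L := sqdist (@lebesgue_measure R) `[0%R, 1%R].
have Lsym f1 f2 : L f1 f2 = L f2 f1 by exact: sqdistC.
pose E := sqdist P setT.
have mS n := measurable_step_integral (hs n).
have mU n := measurable_step_integral (hu n).
have H n : (E X Y <= 2%:E * (E X (step_integral W (s n)) + 2%:E *
    (m2%:E * (2%:E * (L g (step_fun (s n)) + L g (step_fun (u n))))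
     + E Y (step_integral W (u n)))))%E.
  apply: (le_trans (@le_sqdist _ _ _ P setT measurableT
    (step_integral W (s n)) _ _ mX (mS n) mY)).
  rewrite lee_pmul2l//; apply: leeD2l.
  apply: (le_trans (@le_sqdist _ _ _ P setT measurableT
    (step_integral W (u n)) _ _ (mS n) (mU n) mY)).
  rewrite lee_pmul2l// [E Y _]sqdistC; apply: leeD2r.
  rewrite wiener_isometry//; apply: lee_wpmul2l.
    by rewrite -m2E; apply: integral_ge0 => x _; rewrite lee_fin sqr_ge0.
  rewrite (Lsym g (step_fun (s n))).
  by apply: le_sqdist => //; apply: measurable_step_fun.
have c0D (v w : nat -> \bar R) : v @ \oo --> 0%E -> w @ \oo --> 0%E ->
    (v n + w n)%E @[n --> \oo] --> 0%E.
  by move=> v0 w0; rewrite -[X in _ --> X]adde0; exact: cvgeD.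
have c0Z k (v : nat -> \bar R) : v @ \oo --> 0%E ->
    (k%:E * v n)%E @[n --> \oo] --> 0%E.
  by move=> v0; rewrite -[X in _ --> X](mule0 k%:E); exact: cvgeZl.
rewrite unlock in Xs Yu.
apply: cvge_ge; last first.
  apply: (c0Z 2); apply: (c0D); first exact: Xs.
  apply: (c0Z 2); apply: (c0D); last exact: Yu.
  apply: (c0Z m2); apply: (c0Z 2); apply: (c0D); [exact: cs|exact: cu].
exact: nearW H.
exact: eventually_filter.
Qed.

End wiener.

(** * Calculus on the unit interval *)

Section calculus01.
Context {R : realType}.
Implicit Types (g y dy : R -> R) (t : R).

Lemma continuous01P g : {within `[0, 1], continuous g} <->
  forall t, 0 <= t <= 1 -> forall e, 0 < e -> exists2 r, 0 < r &
    forall s, 0 <= s <= 1 -> `|t - s| < r -> `|g t - g s| < e.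
Proof.
split.
  move=> /subspace_continuousP cg t t01 e e0.
  have /= := cg t; rewrite in_itv/= => /(_ t01) /cvgrPdist_lt /(_ _ e0).
  move=> /nbhs_ballP[r /= r0 H]; exists r => // s s01 st.
  by apply: H => //=; rewrite in_itv.
move=> cg; apply/subspace_continuousP => t /=; rewrite in_itv/= => t01.
apply/cvgrPdist_lt => e e0; have [r r0 H] := cg t t01 e e0.
by apply/nbhs_ballP; exists r => //= s /= st; rewrite in_itv/= => s01; exact: H.
Qed.

Lemma C1_quotient y dy t e : C1_on01 y dy -> 0 <= t <= 1 -> 0 < e ->
  exists2 r, 0 < r & forall s, 0 <= s <= 1 -> `|t - s| < r -> s != t ->
    `|dy t - (y s - y t) / (s - t)| < e.
Proof.
move=> [_ dyE] t01 e0; have /cvgrPdist_lt /(_ _ e0) := dyE t t01.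
move=> /nbhs_ballP[r /= r0 H]; exists r => // s s01 st sNt.
by apply: H => //=; rewrite in_itv.
Qed.

Lemma C1_continuous y dy : C1_on01 y dy -> {within `[0, 1], continuous y}.
Proof.
move=> yC1; apply/continuous01P => t t01 e e0.
have [r r0 H] := C1_quotient yC1 t01 ltr01.
have c0 : 0 < `|dy t| + 1 by rewrite ltr_wpDl.
exists (Num.min r (e / (`|dy t| + 1))); first by rewrite lt_min r0 divr_gt0.
move=> s s01; rewrite lt_min => /andP[sr se].
have [->|sNt] := eqVneq s t; first by rewrite subrr normr0.
have st0 : s - t != 0 by rewrite subr_eq0.
rewrite distrC -(divfK st0 (y s - y t)) normrM [`|s - t|]distrC.
apply: le_lt_trans (_ : (`|dy t| + 1) * `|t - s| < e); last first.
  by rewrite mulrC -ltr_pdivlMr.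
apply: ler_wpM2r => //; have := H s s01 sr sNt.
rewrite distrC; set q := _ / _ => qd.
by rewrite -(subrK (dy t) q) addrC (le_trans (ler_normD _ _))// lerD2l ltW.
Qed.

(** At interior points the one-sided clause in the definition of C1 paths is
    void, and the difference quotient is the usual one. *)
Lemma C1_is_derive y dy t : C1_on01 y dy -> t \in `]0, 1[ ->
  is_derive t 1 y (dy t).
Proof.
move=> yC1; rewrite in_itv/= => /andP[t0 t1].
have t01 : 0 <= t <= 1 by rewrite !ltW.
have dE : h^-1 *: ((y \o shift t) (h *: 1) - y t) @[h --> 0^'] --> dy t.
  apply/cvgrPdist_lt => e e0; have [r r0 H] := C1_quotient yC1 t01 e0.
  apply/nbhs_ballP; exists (Num.min r (Num.min t (1 - t))) => /=.
    by rewrite !lt_min r0 t0 subr_gt0.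
  move=> h /=; rewrite -ball_normE /= sub0r normrN !lt_min => /and3P[hr ht h1t] h0.
  have -> : h%:A = h :> R by rewrite -[RHS]mulr1.
  have /andP[h1 h2] : - t < h < t by rewrite -ltr_norml.
  have /andP[h3 h4] : - (1 - t) < h < 1 - t by rewrite -ltr_norml.
  have /= := H (h + t); rewrite addrK -[X in `|dy t - X|]mulrC; apply.
  - by apply/andP; split; lra.
  - by rewrite opprD addrCA subrr addr0 normrN.
  - by rewrite -subr_eq0 addrK.
split; first by apply: cvgP dE.
by rewrite /derive; apply: cvg_lim.
Qed.

Lemma C1_lipschitz y dy D : C1_on01 y dy ->
  (forall t, 0 <= t <= 1 -> `|dy t| <= D) ->
  forall s t, 0 <= s <= 1 -> 0 <= t <= 1 -> `|y t - y s| <= D.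
Proof.
move=> yC1 dyD.
have D0 : 0 <= D by apply: le_trans (dyD 0 _); rewrite ?lexx ?ler01.
move=> s t; wlog st : s t / s <= t.
  move=> wl s01 t01; have [st|/ltW ts] := leP s t; first exact: wl.
  by rewrite distrC; exact: wl.
move=> /andP[s0 s1] /andP[t0 t1].
have sub a : a \in `]s, t[ -> a \in `]0, 1[.
  rewrite !in_itv/= => /andP[sa at']; apply/andP; split; lra.
have [| |c] := @MVT_segment _ y dy s t st.
- by move=> a /sub; exact: C1_is_derive.
- have st01 : `[s, t] `<=` `[0, 1].
    by move=> a /=; rewrite !in_itv/= => /andP[sa at']; apply/andP; split; lra.
  exact: continuous_subspaceW st01 (C1_continuous yC1).
- rewrite in_itv/= => /andP[sc ct] ->; rewrite normrM -[leRHS]mulr1.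
rewrite ler_pM//; first by apply: dyD; apply/andP; split; lra.
by rewrite ger0_norm ?subr_ge0//; lra.
Qed.

(** Bounds on a continuous velocity need only be checked at rational times,
    where countably many almost sure statements can be used at once. *)
Lemma rat_dense01 g a D : {within `[0, 1], continuous g} ->
  (forall q : rat, 0 <= (ratr q : R) <= 1 -> `|g (ratr q) - a| <= D) ->
  forall t, 0 <= t <= 1 -> `|g t - a| <= D.
Proof.
move=> /continuous01P cg qD t t01; rewrite leNgt; apply/negP => Dt.
have [|r r0 H] := cg t t01 (`|g t - a| - D); first by rewrite subr_gt0.
have /rat_in_itvoo[q] : Num.max 0 (t - r) < Num.min 1 (t + r).
  by move/andP: t01 => [t0 t1]; rewrite lt_min !gt_max; apply/andP; split; apply/andP; split; lra.
rewrite in_itv/= lt_min gt_max => /andP[/andP[q0 qt] /andP[q1 tq]].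
have q01 : 0 <= (ratr q : R) <= 1 by rewrite !ltW.
have /(H _ q01) : `|t - ratr q| < r by rewrite ltr_norml; apply/andP; split; lra.
have := qD q q01; have := ler_normD (g t - g (ratr q)) (g (ratr q) - a).
rewrite subrKA; lra.
Qed.

Lemma integrable01 g t : {within `[0, 1], continuous g} -> t <= 1 ->
  (@lebesgue_measure R).-integrable `[0, t] (EFin \o g).
Proof.
move=> cg t1; apply: continuous_compact_integrable; first exact: segment_compact.
have t01 : `[0, t] `<=` `[0, 1].
  by move=> a /=; rewrite !in_itv/= => /andP[-> /le_trans->].
exact: continuous_subspaceW t01 cg.
Qed.

Lemma Rintegral01_cst (c : R) : \int[@lebesgue_measure R]_(_ in `[0%R, 1%R]) c = c.
Proof.
by rewrite Rintegral_cst//= lebesgue_measure_itv/= lte01 oppr0 adde0 mulr1.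
Qed.

Lemma normr_Rintegral01_le g t c : {within `[0, 1], continuous g} ->
  0 <= t <= 1 -> (forall s, 0 <= s <= 1 -> `|g s| <= c) ->
  `|\int[@lebesgue_measure R]_(s in `[0, t]) g s| <= c.
Proof.
move=> cg /andP[t0 t1] gc; have Ig := integrable01 cg t1.
have c0 : 0 <= c by apply: le_trans (gc 0 _); rewrite ?lexx ?ler01.
apply: le_trans (le_normr_Rintegral _ Ig) _ => //.
apply: (@le_trans _ _ (\int[@lebesgue_measure R]_(s in `[0, t]) c)).
  apply: le_Rintegral => //.
  - exact: integrable_norm.
  - by apply: (integrable01 (g := cst c)) => //; apply: continuous_subspaceT => ?; exact: cvg_cst.
  - by move=> s /=; rewrite in_itv/= => /andP[s0 st]; apply: gc; rewrite s0 (le_trans st).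
rewrite Rintegral_cst//= lebesgue_measure_itv/= lte_fin; case: ltP => _; rewrite ?mulr0//.
by rewrite oppr0 adde0/= ler_piMr.
Qed.

End calculus01.

(** * Pathwise analysis of the boundary value problem *)

Section boundary_value_problem.
Context {R : realType}.
Local Notation lambda := (@lebesgue_measure R).
Variables (p : R) (B : R -> R -> R) (f : R -> R) (K L F : R).
Hypothesis p_gt0 : 0 < p.
Hypothesis cB : {within `[0, 1] `*` [set: R],
                   continuous (fun z : R * R => B z.1 z.2)}.
Hypothesis BK : forall t x : R, 0 <= t <= 1 -> `|B t x| <= K.
Hypothesis L_lt_p : L < p.
Hypothesis BL : forall t x y : R, 0 <= t <= 1 -> `|B t x - B t y| <= L * `|x - y|.
Hypothesis cf : {within `[0, 1], continuous f}.
Hypothesis fF : forall t : R, 0 <= t <= 1 -> `|f t| <= F.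

Lemma within_continuous_superposition (y : R -> R) : {within `[0, 1], continuous y} ->
  {within `[0, 1], continuous (fun s => B s (y s))}.
Proof.
move=> /continuous01P cy; apply/continuous01P => t t01 e e0.
have /subspace_continuousP/(_ (t, y t)) /= := cB.
rewrite in_itv/= => /(_ (conj t01 Logic.I)) /cvgrPdist_lt /(_ _ e0).
move=> /nbhs_ballP[r /= r0 H].
have [r' r'0 H'] := cy t t01 r r0.
exists (Num.min r r'); first by rewrite lt_min r0.
move=> s s01; rewrite lt_min => /andP[sr sr'].
by have /= := H (s, y s); apply; [split => //; exact: H'|split => //; rewrite in_itv].
Qed.

Let L_ge0 : 0 <= L.
Proof.
have := BL (t := 0) 0 1; rewrite lexx ler01 => /(_ isT).
by rewrite sub0r normrN normr1 mulr1; apply: le_trans.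
Qed.

Let cst01 (c : R) : {within `[0, 1], continuous (fun _ : R => c)}.
Proof. by apply: continuous_subspaceT => ?; exact: cvg_cst. Qed.

Let within01D (g h : R -> R) : {within `[0, 1], continuous g} ->
  {within `[0, 1], continuous h} -> {within `[0, 1], continuous (fun s => g s + h s)}.
Proof. by move=> cg ch t; apply: cvgD; [exact: cg|exact: ch]. Qed.

Let within01Z (k : R) (g : R -> R) : {within `[0, 1], continuous g} ->
  {within `[0, 1], continuous (fun s => k * g s)}.
Proof. by move=> cg t; apply: cvgM; [exact: cvg_cst|exact: cg]. Qed.

Let int01 (g : R -> R) : {within `[0, 1], continuous g} ->
  lambda.-integrable `[0, 1] (EFin \o g).
Proof. by move=> cg; exact: integrable01. Qed.

(** The map B_0 of the theorem. *)
Definition averaged_drift (x : R) : R :=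
  x + p^-1 * \int[lambda]_(s in `[0, 1]) B s x.

(** The integral term is Lipschitz with constant L / p < 1, so it cannot
    compensate the identity. *)
Lemma averaged_drift_expands x y :
  (p - L) / p * `|x - y| <= `|averaged_drift x - averaged_drift y|.
Proof.
have cx (z : R) : {within `[0, 1], continuous (fun s => B s z)}.
   exact: (@within_continuous_superposition (fun=> z) (@cst01 z)).
rewrite /averaged_drift opprD addrACA -mulrBr -RintegralB//; try exact: int01.
set I := Rintegral _ _ _.
have IL : `|I| <= L * `|x - y|.
  apply: normr_Rintegral01_le; rewrite ?ler01 ?lexx//.
    by move=> t; apply: cvgB; exact: cx.
  by move=> s s01; exact: BL.
have pI : `|p^-1 * I| <= p^-1 * (L * `|x - y|).
  by rewrite normrM gtr0_norm ?invr_gt0// ler_wpM2l// invr_ge0 ltW.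
have -> : (p - L) / p * `|x - y| = `|x - y| - p^-1 * (L * `|x - y|).
  by field; rewrite gt_eqF.
have := ler_normB (x - y + p^-1 * I) (p^-1 * I); rewrite addrK; lra.
Qed.

(** Injective because it expands distances; surjective by the intermediate
    value theorem, as it stays within K / p of the identity. *)
Lemma averaged_drift_bijective : bijective averaged_drift.
Proof.
have cx (z : R) : {within `[0, 1], continuous (fun s => B s z)}.
  exact: (@within_continuous_superposition (fun=> z) (@cst01 z)).
have pV0 : 0 < p^-1 by rewrite invr_gt0.
have pL0 : 0 < (p - L) / p by rewrite divr_gt0// subr_gt0.
have inj : injective averaged_drift.
  move=> x y xy; have := averaged_drift_expands x y.
  rewrite xy subrr normr0 pmulr_rle0// normr_le0 subr_eq0 => /eqP//.
have near_id x : `|averaged_drift x - x| <= p^-1 * K.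
  rewrite /averaged_drift addrAC subrr add0r normrM gtr0_norm// ler_pM2l//.
  by apply: normr_Rintegral01_le; rewrite ?ler01 ?lexx// => s s01; exact: BK.
have lip x y : `|averaged_drift x - averaged_drift y| <= 2 * `|x - y|.
  rewrite /averaged_drift opprD addrACA -mulrBr -RintegralB//; try exact: int01.
  apply: le_trans (ler_normD _ _) _; rewrite mulr_natl [leRHS]mulr2n lerD2l normrM gtr0_norm//.
  rewrite ler_pdivrMl//; apply: normr_Rintegral01_le; rewrite ?ler01 ?lexx//.
    by move=> t; apply: cvgB; exact: cx.
  move=> s s01; apply: le_trans (BL _ _ s01) _.
  by rewrite ler_wpM2r// ltW.
have cont : continuous averaged_drift.
  move=> x; apply/cvgrPdist_le => e e0; apply/nbhs_ballP; exists (e / 2) => /=.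
    by rewrite divr_gt0.
  move=> y /= xy; apply: le_trans (lip _ _) _.
  by rewrite mulrC -ler_pdivlMr// ltW.
have surj z : exists x, averaged_drift x = z.
  have K0 : 0 <= p^-1 * K by apply: le_trans (near_id 0).
  have [| | |x _ <-] := @IVT _ averaged_drift (z - p^-1 * K) (z + p^-1 * K) z.
  - lra.
  - exact: continuous_subspaceT.
  - have := near_id (z - p^-1 * K); have := near_id (z + p^-1 * K).
    rewrite !ler_norml ge_min le_max => /andP[h1 h2] /andP[h3 h4].
    by apply/andP; split; apply/orP; [left|right]; lra.
  by exists x.
have [g gK] := choice surj; exists g => // x.
by apply: inj; rewrite gK.
Qed.

Let A_integral_bound (A : R -> R -> R) (y : R -> R) N :
  (forall t x : R, 0 <= t <= 1 -> A t x = p * x + B t x) ->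
  {within `[0, 1], continuous y} ->
  (forall t : R, 0 <= t <= 1 -> `|y t| <= N) ->
  forall t : R, 0 <= t <= 1 ->
    `|\int[lambda]_(s in `[0, t]) (A s (y s) + f s)| <= p * N + (K + F).
Proof.
move=> AE cy yN t t01.
have -> : \int[lambda]_(s in `[0, t]) (A s (y s) + f s) =
    \int[lambda]_(s in `[0, t]) (p * y s + (B s (y s) + f s)).
  apply: eq_Rintegral => s; rewrite inE/= in_itv/= => /andP[s0 st].
  by case/andP: t01 => t0 t1; rewrite AE ?addrA// s0 (le_trans st).
apply: normr_Rintegral01_le => //.
  apply: within01D; first exact: within01Z.
  by apply: within01D => //; exact: within_continuous_superposition.
move=> s s01; apply: le_trans (ler_normD _ _) _; apply: lerD.
  by rewrite normrM gtr0_norm// ler_pM2l// yN.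
by apply: le_trans (ler_normD _ _) _; apply: lerD; [exact: BK|exact: fF].
Qed.

(** Solving the equation for the stochastic term leaves only a continuous
    velocity and the integral of a bounded function. *)
Lemma forcing_bounded (A : R -> R -> R) eps (y dy m : R -> R) :
  (forall t x : R, 0 <= t <= 1 -> A t x = p * x + B t x) ->
  0 < eps -> C1_on01 y dy ->
  (forall t : R, 0 <= t <= 1 -> dy t = dy 0
     + eps ^+ 2 * (\int[lambda]_(s in `[0, t]) (A s (y s) + f s))
     + eps ^+ 2 * m t) ->
  exists S, forall t : R, 0 <= t <= 1 -> `|m t| <= S.
Proof.
move=> AE eps0 yC1 eqn; have cy := C1_continuous yC1.
have bounded (g : R -> R) : {within `[0, 1], continuous g} ->
    exists N, forall t : R, 0 <= t <= 1 -> `|g t| <= N.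
  move=> cg; have [|c _ H] := @EVT_max _ (fun t => `|g t|) 0 1 ler01.
    by move=> t; apply: cvg_norm; exact: cg.
  by exists `|g c| => t t01; apply: H; rewrite in_itv.
have [N yN] := bounded _ cy.
have [D dyD] := bounded _ yC1.1.
have e20 : 0 < eps ^+ 2 by rewrite exprn_gt0.
exists ((eps ^+ 2)^-1 * (2 * D) + (p * N + (K + F))) => t t01.
have -> : m t = (eps ^+ 2)^-1 * (dy t - dy 0)
    - \int[lambda]_(s in `[0, t]) (A s (y s) + f s).
  by rewrite (eqn t t01); field; rewrite gt_eqF.
apply: le_trans (ler_normB _ _) _; apply: lerD; last exact: A_integral_bound.
rewrite normrM gtr0_norm ?invr_gt0// ler_pM2l ?invr_gt0//.
apply: le_trans (ler_normB _ _) _; rewrite mulr_natl mulr2n.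
by apply: lerD; apply: dyD; rewrite ?t01 ?lexx ?ler01.
Qed.

(** The pathwise estimate. With C = K + F + S, the balance over [0, 1] bounds the
    mean of y by C / p, and the smallness of eps turns the oscillation bound,
    which involves the maximum N of |y|, into p * N <= 3 * C. The oscillation is
    then at most 8 * eps ^ 2 * C; it enters B_0(y t) - B_0(z) at most twice,
    and p / (p - L) is the Lipschitz constant of the inverse of B_0. *)
Lemma bvp_distance_le (A : R -> R -> R) bc eps (y dy m : R -> R) S z :
  (forall t x : R, 0 <= t <= 1 -> A t x = p * x + B t x) ->
  0 < eps -> 4 * p * eps ^+ 2 <= 1 ->
  C1_on01 y dy -> satisfies_bc bc y dy ->
  (forall t : R, 0 <= t <= 1 -> dy t = dy 0
     + eps ^+ 2 * (\int[lambda]_(s in `[0, t]) (A s (y s) + f s))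
     + eps ^+ 2 * m t) ->
  (forall q : rat, 0 <= (ratr q : R) <= 1 -> `|m (ratr q)| <= S) ->
  averaged_drift z = - p^-1 * (\int[lambda]_(s in `[0, 1]) f s) - p^-1 * m 1 ->
  forall t : R, 0 <= t <= 1 ->
    `|y t - z| <= 16 * p / (p - L) * eps ^+ 2 * (K + F + S).
Proof.
move=> AE eps0 eps_small yC1 bcy eqn mS zE.
set C := K + F + S; set e2 := eps ^+ 2.
have e20 : 0 < e2 by rewrite exprn_gt0.
have pV0 : 0 < p^-1 by rewrite invr_gt0.
have z01 : 0 <= (0 : R) <= 1 by rewrite lexx ler01.
have o01 : 0 <= (1 : R) <= 1 by rewrite lexx ler01.
have cy := C1_continuous yC1.
have cBy := within_continuous_superposition cy.
have [c c01 yc] : exists2 c, 0 <= c <= 1 & forall t, 0 <= t <= 1 -> `|y t| <= `|y c|.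
  have [|c] := @EVT_max _ (fun t => `|y t|) 0 1 ler01.
    by move=> t; apply: cvg_norm; exact: cy.
  by rewrite in_itv/= => c01 H; exists c => // t t01; apply: H; rewrite in_itv.
set N := `|y c| in yc.
pose G s := p * y s + (B s (y s) + f s).
have GN := A_integral_bound AE cy yc.
have dy01 : dy 0 = dy 1 by case: bc bcy => [[-> ->]|[]].
have G1 : \int[lambda]_(s in `[0, 1]) G s = - m 1.
  have -> : \int[lambda]_(s in `[0, 1]) G s =
      \int[lambda]_(s in `[0, 1]) (A s (y s) + f s).
    by apply: eq_Rintegral => s; rewrite inE/= in_itv/= => s01; rewrite AE// /G addrA.
  have := eqn 1 o01; rewrite -dy01 -addrA -mulrDr => /eqP.
  rewrite -subr_eq0 opprD addNKr oppr_eq0 mulf_eq0 gt_eqF//= addr_eq0 => /eqP//.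
have [c' c'01 dyc'] : exists2 c', 0 <= c' <= 1 & dy c' = 0.
  case: bc bcy => [[dy0 _]|[y01 _]]; first by exists 0.
  have dy_ex x : x \in `]0, 1[ -> derivable y x 1.
    by move=> x01; case: (C1_is_derive yC1 x01).
  have [c' c'01 D0] := Rolle ltr01 dy_ex cy y01.
  exists c'; first by move: c'01; rewrite in_itv/= => /andP[*]; rewrite !ltW.
  by case: (C1_is_derive yC1 c'01) => _ <-; case: D0.
pose D := e2 * (p * N + C).
(* The velocity varies by at most D, and by osc below y varies by at most
   2 * D. *)
have dyD t : 0 <= t <= 1 -> `|dy t - dy 0| <= D.
  apply: rat_dense01; first by case: yC1.
  move=> q q01.
  rewrite (eqn _ q01) -/e2.
  rewrite (_ : _ - dy 0 = e2 *
    (\int[lambda]_(s in `[0, ratr q]) (A s (y s) + f s) + m (ratr q)));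
    last by ring.
  rewrite normrM gtr0_norm//.
  rewrite ler_pM2l// /C addrA; apply: le_trans (ler_normD _ _) _.
  by apply: lerD; [exact: GN|exact: mS].
have osc s t : 0 <= s <= 1 -> 0 <= t <= 1 -> `|y t - y s| <= 2 * D.
  apply: (C1_lipschitz yC1) => {s t} t t01.
  have := dyD t t01; have := dyD c' c'01; rewrite dyc' sub0r normrN.
  have := ler_normD (dy t - dy 0) (dy 0); rewrite subrK; lra.
pose Iy := \int[lambda]_(s in `[0, 1]) y s.
pose IB := \int[lambda]_(s in `[0, 1]) B s (y s).
pose If := \int[lambda]_(s in `[0, 1]) f s.
have balance : p * Iy + (IB + If) = - m 1.
  rewrite -G1 /G RintegralD//; try exact: int01; last first.
  - by apply: int01; exact: within01D.
  - by apply: int01; exact: within01Z.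
  by rewrite RintegralZl// ?RintegralD//; exact: int01.
have meanD t : 0 <= t <= 1 -> `|y t - Iy| <= 2 * D.
  move=> t01; rewrite -[y t]Rintegral01_cst -RintegralB//; try exact: int01.
  apply: normr_Rintegral01_le => //.
    by move=> s; apply: cvgB; [exact: cst01|exact: cy].
  by move=> s s01; exact: osc.
have pIy : p * `|Iy| <= C.
  rewrite -[p]gtr0_norm// -normrM.
  have -> : p * Iy = - m 1 - IB - If by rewrite -balance; ring.
  have m1S : `|m 1| <= S by have := mS 1; rewrite rmorph1 => /(_ o01).
  have IBK : `|IB| <= K.
    by apply: normr_Rintegral01_le => // s s01; exact: BK.
  have IfF : `|If| <= F by exact: normr_Rintegral01_le.
  have := ler_normB (- m 1 - IB) If; have := ler_normB (- m 1) IB.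
  rewrite normrN /C; lra.
have pN : p * N <= 3 * C.
  have := meanD c c01; have := ler_normD (y c - Iy) Iy; rewrite subrK -/N => h1 h2.
  have N0 : 0 <= N by rewrite /N normr_ge0.
  have C0 : 0 <= C by apply: le_trans pIy; rewrite mulr_ge0// ltW.
  have h3 : p * N <= p * (2 * D) + C.
    by apply: le_trans (_ : p * (2 * D + `|Iy|) <= _); rewrite ?ler_pM2l ?mulrDr ?lerD2l//; lra.
  have h4 : p * (2 * D) <= (p * N + C) / 2.
    rewrite /D (_ : p * _ = (4 * p * e2) * ((p * N + C) / 2)); last by field.
    rewrite -[leRHS]mul1r ler_wpM2r// divr_ge0// addr_ge0// mulr_ge0// ltW//.
  lra.
have DC : 2 * D <= 8 * e2 * C.
  rewrite /D (_ : 8 * e2 * C = 2 * (e2 * (4 * C))); last by ring.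
  rewrite ler_pM2l// ler_pM2l//; lra.
move=> t t01.
have key : averaged_drift (y t) - averaged_drift z =
    (y t - Iy) + p^-1 * \int[lambda]_(s in `[0, 1]) (B s (y t) - B s (y s)).
  rewrite RintegralB//; try exact: int01; last first.
    by apply: int01; exact: (@within_continuous_superposition (fun=> y t) (@cst01 (y t))).
  rewrite zE -/If -/IB /averaged_drift.
  have -> : m 1 = - (p * Iy + (IB + If)) by rewrite balance opprK.
  by field; rewrite gt_eqF.
have keyD : `|averaged_drift (y t) - averaged_drift z| <= 4 * D.
  rewrite key; apply: le_trans (ler_normD _ _) _.
  have -> : 4 * D = 2 * D + 2 * D by ring.
  apply: lerD; first exact: meanD.
  rewrite normrM gtr0_norm// ler_pdivrMl//.
  apply: normr_Rintegral01_le => //.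
    move=> s; apply: cvgB; last exact: cBy.
    exact: (@within_continuous_superposition (fun=> y t) (@cst01 (y t))).
  move=> s s01; apply: le_trans (BL _ _ s01) _.
  by apply: ler_pM => //; [exact: ltW|exact: osc].
have := le_trans (averaged_drift_expands (y t) z) keyD.
have pL0 : 0 < p - L by rewrite subr_gt0.
rewrite -ler_pdivlMl ?divr_gt0// => /le_trans; apply.
rewrite invf_div (_ : 16 * p / (p - L) * e2 * C = p / (p - L) * (2 * (8 * e2 * C))); last first.
  by field; rewrite gt_eqF.
by rewrite ler_pM2l ?divr_gt0//; lra.
Qed.

End boundary_value_problem.

(** * From almost sure bounds to convergence in probability *)

(** Convergence in probability follows from convergence off arbitrarily small
    events; the null set in the hypothesis may depend on the index i, which
    ranges over an uncountable set in the application. *)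
Lemma cvg_in_probability0_off_events {R : realType} {d} {T : measurableType d}
    (P : probability T R) {I : Type} (F : set_system I) {FF : Filter F}
    (Y : I -> T -> \bar R) (E : nat -> set T) :
  (forall k, measurable (E k)) -> (forall k, E k.+1 `<=` E k) ->
  P.-negligible (\bigcap_k E k) ->
  (forall (r : R) k, 0 < r ->
     \forall i \near F, {ae P, forall w, ~ E k w -> (Y i w <= r%:E)%E}) ->
  cvg_in_probability0 P F Y.
Proof.
move=> mE dE /negligibleP E0 H r r0.
have mcapE : measurable (\bigcap_k E k) by exact: bigcap_measurable.
have PE : (P \o E) k @[k --> \oo] --> 0%E.
  rewrite -(E0 mcapE); apply: nonincreasing_cvg_mu => //.
    by rewrite (le_lt_trans (probability_le1 P (mE 0)))// ltry.
  by apply/nonincreasing_seqP => k; apply/subsetPset.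
have Pge0 X : (0 <= (P^*)%mu X)%E by apply: mu_ext_ge0.
have bound e : 0 < e -> \forall i \near F, ((P^*)%mu [set w | (r%:E < Y i w)%E] < e%:E)%E.
  move=> e0; have [k Pk] : exists k, (P (E k) < e%:E)%E.
    have /fine_cvgP[_ /cvgrPdist_lt /(_ _ e0)] := PE.
    move=> [k _ /(_ k (leqnn k))] /=; rewrite sub0r normrN => Pk.
    exists k; rewrite -(fineK (fin_num_measure P _ (mE k))) lte_fin.
    exact: le_lt_trans (ler_norm _) Pk.
  apply: filterS (H r k r0) => i [N [mN N0 NH]].
  apply: le_lt_trans Pk.
  apply: (@le_trans _ _ ((P^*)%mu (E k `|` N))).
    apply: le_mu_ext => w /= rY; have [|nE] := pselect (E k w); first by left.
    right; apply: NH => /= /(_ nE); apply/negP.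
    by rewrite -ltNge.
  rewrite measurable_mu_extE; last exact: measurableU.
  apply: le_trans (measureU2 _ _ _) _ => //.
  by rewrite [X in (_ + X)%E]N0 adde0.
apply/fine_cvgP; split.
  apply: filterS (bound 1 ltr01) => i Pi.
  by rewrite ge0_fin_numE// (lt_trans Pi)// ltry.
apply/cvgrPdist_lt => e e0; apply: filterS (bound e e0) => i Pi /=.
rewrite sub0r normrN ger0_norm ?fine_ge0//.
by rewrite -lte_fin fineK// ge0_fin_numE// (lt_trans Pi)// ltry.
Qed.

Lemma ae_forall_rat {R : realType} {d} {T : measurableType d}
    (P : {measure set T -> \bar R}) (Q : rat -> T -> Prop) :
  (forall q, {ae P, forall w, Q q w}) -> {ae P, forall w, forall q, Q q w}.
Proof.
move=> HQ.
have : {ae P, forall w, forall n : nat, if unpickle n is Some q then Q q w else True}.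
  apply: ae_foralln => n; case: unpickle => [q|]; first exact: HQ.
  exact: aeW.
by apply: filterS => w H q; have := H (pickle q); rewrite pickleK.
Qed.

(** * Averaging principle *)

Lemma sup_norm_ub {R : realType} {U : Type} (D : set U) (g : U -> R) c :
  (sup_norm D g < c)%E -> forall u, D u -> `|g u| <= fine (sup_norm D g).
Proof.
move=> gc u Du.
have gu : (`|g u|%:E <= sup_norm D g)%E by apply: ereal_sup_ubound; exists u.
rewrite -lee_fin fineK// ge0_fin_numE; first exact: lt_le_trans gc (leey _).
by apply: le_trans gu; rewrite lee_fin.
Qed.

Lemma lipschitz_of_derive1_le {R : realType} (g : R -> R) (L : R) :
  (forall x, derivable g x 1) -> (forall x, `|derive1 g x| <= L) ->
  forall x y, `|g x - g y| <= L * `|x - y|.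
Proof.
move=> dg gL x y; wlog xy : x y / y <= x.
  move=> wl; have [yx|/ltW xy] := leP y x; first exact: wl.
  by rewrite distrC [`|x - y|]distrC; exact: wl.
have [| |c _ ->] := @MVT_segment _ g (derive1 g) y x xy.
- by move=> z _; rewrite derive1E; exact: derivableP.
- by apply: continuous_subspaceT => z; exact/differentiable_continuous/derivable1_diffP/dg.
by rewrite normrM ler_wpM2r.
Qed.

Theorem theorem3p2 (R : realType) (p : R) (A B : R -> R -> R) (f delta : R -> R)
  (d : measure_display) (T : measurableType d) (P : probability T R)
  (W : R -> T -> R) (Idelta : T -> R)
  (p_gt0 : 0 < p)
  (A_form : forall t x : R, 0 <= t <= 1 -> A t x = p * x + B t x)
  (B_cont : {within `[0, 1] `*` [set: R],
               continuous (fun z : R * R => B z.1 z.2)})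
  (B_bounded : (sup_norm (`[0%R, 1%R] `*` [set: R])
                  (fun z : R * R => B z.1 z.2) < +oo)%E)
  (B_derivable : forall t x : R, 0 <= t <= 1 -> derivable (B t) x 1)
  (dB_bounded : (sup_norm (`[0%R, 1%R] `*` [set: R])
                   (fun z : R * R => partial_x B z.1 z.2) < p%:E)%E)
  (dB_unif_cont :
     sup_norm (`[0, 1] `*` [set xy : R * R | `|xy.1 - xy.2| <= h])
       (fun z : R * (R * R) => partial_x B z.1 z.2.1 - partial_x B z.1 z.2.2)
       @[h --> 0^'+] --> 0%E)
  (f_cont : {within `[0, 1], continuous f})
  (delta_L2 : square_integrable01 delta)
  (W_bm : brownian_motion P W)
  (Idelta_int : is_wiener_integral P W delta Idelta) :
  let B0 := fun x : R =>
    x + p^-1 * \int[@lebesgue_measure R]_(s in `[0, 1]) B s x in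
  let eta := fun w : T =>
    - p^-1 * (\int[@lebesgue_measure R]_(s in `[0, 1]) f s) - p^-1 * Idelta w in
  let zeta := fun w : T => pinv [set: R] B0 (eta w) in
  bijective B0 /\
  forall (bc : boundary_condition) (x : R -> R -> T -> R),
    (\forall eps \near 0^'+, is_solution P W A f delta bc eps (x eps)) ->
    cvg_in_probability0 P 0^'+
      (fun eps w => sup_norm `[0%R, 1%R] (fun t => x eps t w - zeta w)).
Proof.
move=> B0 eta zeta.
pose K := fine (sup_norm (`[0%R, 1%R] `*` [set: R]) (fun z : R * R => B z.1 z.2)).
pose L := fine (sup_norm (`[0%R, 1%R] `*` [set: R])
                   (fun z : R * R => partial_x B z.1 z.2)).
have BK t x : 0 <= t <= 1 -> `|B t x| <= K.
  by move=> t01; apply: (sup_norm_ub B_bounded (u := (t, x))); split => //=; rewrite in_itv.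
have dBL t x : 0 <= t <= 1 -> `|partial_x B t x| <= L.
  by move=> t01; apply: (sup_norm_ub dB_bounded (u := (t, x))); split => //=; rewrite in_itv.
have L_lt_p : L < p.
  rewrite -lte_fin fineK// ge0_fin_numE; first exact: lt_le_trans dB_bounded (leey _).
  apply: (@le_trans _ _ (`|partial_x B 0 0|%:E)); first by rewrite lee_fin.
  by apply: ereal_sup_ubound; exists (0, 0) => //=; split => //=; rewrite in_itv/= lexx ler01.
have BL t x y : 0 <= t <= 1 -> `|B t x - B t y| <= L * `|x - y|.
  by move=> t01; apply: lipschitz_of_derive1_le => z; [exact: B_derivable|exact: dBL].
have [F fF] : exists F, forall t : R, 0 <= t <= 1 -> `|f t| <= F.
  have [|c _ H] := @EVT_max _ (fun t => `|f t|) 0 1 ler01.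
    by move=> t; apply: cvg_norm; exact: f_cont.
  by exists `|f c| => t t01; apply: H; rewrite in_itv.
have B0bij : bijective B0 := averaged_drift_bijective p_gt0 B_cont BK L_lt_p BL.
split => // bc x solx.
have zetaE w : averaged_drift p B (zeta w) = eta w.
  have [g _ gK] := B0bij.
  by apply: pinvK; rewrite inE; exists (g (eta w)).
(* The solution at one fixed eps provides the bound on the stochastic term that
   serves for all smaller eps. *)
have [e0 [e0_gt0 [_ [v [M0 [M0int sol0]]]]]] :
    exists e, 0 < e /\ is_solution P W A f delta bc e (x e).
  have [r /= r0 H] := solx; exists (r / 2); split; first by rewrite divr_gt0.
  apply: H; last by rewrite divr_gt0.
  by rewrite /= sub0r normrN gtr0_norm ?divr_gt0// gtr_pMr// invf_lt1// ltr1n.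
have mdelta t : measurable_fun (`[0, 1] : set R) (fun s => delta s * \1_(`[0, t]) s).
  by apply: measurable_funM => //; case: delta_L2.
pose E k := \bigcup_q [set w | (0 <= (ratr q : R) <= 1) /\ k%:R < `|M0 (ratr q) w|].
have mE k : measurable (E k).
  apply: bigcupT_measurable_rat => q.
  have [q01|nq01] := pselect (is_true (0 <= (ratr q : R) <= 1)); last first.
    by rewrite (_ : [set w | _] = set0)//; apply/seteqP; split => w //= [].
  rewrite (_ : [set w | _] = (fun w => `|M0 (ratr q) w|) @^-1` `]k%:R, +oo[%classic).
    have mM0 : measurable_fun [set: T] (fun w => `|M0 (ratr q) w|).
      by apply: measurableT_comp => //; case: (M0int _ q01).
    by rewrite -[X in measurable X]setTI; exact: mM0.
  by apply/seteqP; split => [w /= [_]|w /=]; rewrite in_itv/= andbT.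
have Edec k : E k.+1 `<=` E k.
  by move=> w [q _ [q01 kM]]; exists q => //; split => //; apply: lt_trans kM; rewrite ltr_nat.
have E0 : P.-negligible (\bigcap_k E k).
  apply: negligibleS sol0 => w /= Ew [C1 _ eqn].
  have [S MS] := forcing_bounded p_gt0 B_cont BK f_cont fF A_form e0_gt0 C1 eqn.
  have [q _ [q01]] := Ew (Num.truncn S).+1 Logic.I.
  apply/negP; rewrite -leNgt; apply: le_trans (MS _ q01) _.
  exact/ltW/truncnS_gt.
apply: (cvg_in_probability0_off_events (E := E)) => // r k r0.
pose c := 16 * p / (p - L) * (K + F + k%:R).
have c_ge0 : 0 <= c.
  have z01 : 0 <= (0 : R) <= 1 by rewrite lexx ler01.
  have pL0 : 0 < p - L by rewrite subr_gt0.
  apply: mulr_ge0; first by rewrite divr_ge0 ?mulr_ge0// ltW.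
  apply: addr_ge0 => //; apply: addr_ge0.
    exact: le_trans (BK 0 0 z01).
  exact: le_trans (fF 0 z01).
near=> eps.
have eps0 : 0 < eps by [].
have eps1 : eps <= 1 by near: eps; apply: nbhs_right_le.
have [_ [xdot [M [Mint sol]]]] : is_solution P W A f delta bc eps (x eps) by near: eps.
have eps2 : eps ^+ 2 <= eps by rewrite expr2 ger_pMl.
have epsp : 4 * p * eps ^+ 2 <= 1.
  rewrite -ler_pdivlMl ?mulr_gt0// mulr1; apply: le_trans eps2 _.
  by near: eps; apply: nbhs_right_le; rewrite invr_gt0 mulr_gt0.
have epsc : c * eps ^+ 2 <= r.
  apply: le_trans (_ : (c + 1) * eps <= r).
    by apply: ler_pM => //; rewrite ?sqr_ge0// lerDl.
  rewrite -ler_pdivlMl ?ltr_wpDl//.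
  by near: eps; apply: nbhs_right_le; rewrite mulr_gt0// invr_gt0 ltr_wpDl.
(* The forcing process of the solution at eps is a version of the reference
   one. *)
have MM0 : {ae P, forall w, forall q : rat, 0 <= (ratr q : R) <= 1 ->
    M (ratr q) w = M0 (ratr q) w}.
  apply: ae_forall_rat => q.
  have [q01|nq01] := pselect (is_true (0 <= (ratr q : R) <= 1)); last exact: aeW.
  have := wiener_integral_unique W_bm (mdelta _) (Mint _ q01) (M0int _ q01).
  by apply: filterS => w.
have o01 : 0 <= (1 : R) <= 1 by rewrite lexx ler01.
have MI : {ae P, forall w, M 1 w = Idelta w}.
  apply: (wiener_integral_unique W_bm (mdelta 1) (Mint 1 o01)).
  case: Idelta_int => mI [s [s01 ds Is]]; split => //; exists s; split => //.
  apply: cvg_trans ds; apply: near_eq_cvg; apply: nearW => n.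
  apply: eq_integral => t t01.
  by rewrite indicE t01 mulr1.
apply: filterS3 sol MM0 MI => w [C1 bcw eqn] Mq M1 nE.
apply: ge_ereal_sup => _ [t t01 <-]; rewrite lee_fin.
apply: le_trans epsc; rewrite /c mulrAC.
rewrite /= in_itv/= in t01.
have main := bvp_distance_le p_gt0 B_cont BK L_lt_p BL f_cont fF A_form eps0 epsp C1 bcw eqn.
apply: main t01.
  move=> q q01; rewrite Mq// leNgt; apply/negP => kM.
  by apply: nE; exists q.
by rewrite zetaE /eta M1.
Unshelve. all: by end_near.
Qed.
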